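(* Let $V\subset A^n$ be a neighborly $d$-code in standard form, with $C^1_0=\{2,\ldots,s\}$, and let $M\ge 2$ be an integer such that $|V|=2^d-M$ and $|V^{1,0}|>9M$. Then for every inflation $V^\delta$ of $V$ on the set $J=C^1_0=\{2,\ldots,s\}$ we have $$V^{\delta}=\{0*\cdots *\}\cup V^{1,1}.$$ Moreover, if $V^{1,*}\neq\emptyset$, then $\operatorname{vol}(V^\delta)>\operatorname{vol}(V)$ for every inflation $V^\delta$ of $V$ on $J$, and consequently $|V^{1,*}|<M$ and $|V^{1,0}|>2^{d-1}-M$, $|V^{1,1}|>2^{d-1}-M$.
   Context: Words and codes. Let $A=\{0,1,*\}$, and for a positive integer $n$ let $A^n$ be the set of all words $v=v_1\ldots v_n$ with $v_i\in A$ for $i\in[n]=\{1,\ldots,n\}$. For $v\in A^n$ put $\operatorname{prop}(v)=\{i\in[n]\colon v_i\neq *\}$. Two words $v,u\in A^n$ are dichotomous at the $i$-th position if $v_i,u_i\in\{0,1\}$ and $v_i+u_i=1$; they are dichotomous if this holds for some $i\in[n]$, and neighborly if there is precisely one such $i$. A set $V\subset A^n$ is a code if every two distinct words in $V$ are dichotomous, and a neighborly code if every two distinct words in $V$ are neighborly. For $d\ge1$, a code $V$ is a $d$-code if $|\operatorname{prop}(v)|=d$ for every $v\in V$; a neighborly $d$-code is a $d$-code which is a neighborly code. For $v\in A^n$ put $|v|=2^{n-|\operatorname{prop}(v)|}$, and for a code $V\subset A^n$ put $\operatorname{vol}(V)=\sum_{v\in V}|v|$; $|V|$ denotes the cardinality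 of the set $V$. For $j\in[n]$ and $a\in A$ let $V^{j,a}=\{v\in V\colon v_j=a\}$. The word $0*\cdots *\in A^n$ has first letter $0$ and all other letters $*$. Standard form. For a neighborly code $V\subset A^n$ and $\varepsilon\in\{0,1\}$ let $C^1_\varepsilon$ be the set of all $k\in[n]\setminus\{1\}$ for which there are $v,u\in V^{1,\varepsilon}$ with $v_k,u_k\in\{0,1\}$ and $v_k+u_k=1$. The code $V$ is in standard form if: (i) $|V^{1,0}|=\max_{i\in[n],\,\varepsilon\in\{0,1\}}|V^{i,\varepsilon}|$; (ii) $|V^{1,0}|\ge 2$ and $|V^{1,1}|\ge 2$ (for a neighborly code this implies that $C^1_0$ and $C^1_1$ are non-empty and disjoint); (iii) $C^1_0=\{2,\ldots,s\}$ and $C^1_1=\{s+1,\ldots,r\}$ for some $s,r\in[n]$, so that $D=[n]\setminus(\{1\}\cup C^1_0\cup C^1_1)$ is either empty or equal to $\{r+1,\ldots,n\}$; (iv) if $D\neq\emptyset$, then $v_k\in\{0,*\}$ for every $k\in D$ and every $v\in V^{1,0}\cup V^{1,1}$. Inflation. Let $V\subset A^n$ be a code and $i\in[n]$. For $\eta\in\{0,1\}$ let $V^{i,\eta,*}=\{v_1\ldots v_{i-1}*v_{i+1}\ldots v_n\colon v\in V^{i,\eta}\}$. An inflation of $V$ at the $i$-th position is the code $V^{\delta_i}=V^{i,\delta_i,*}\cup V^{i,*}$, where $\delta_i\in\{0,1\}$ is such that $\operatorname{vol}(V^{i,\delta_i'})\le\operatorname{vol}(V^{i,\delta_i})$ with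 $\delta_i'=1-\delta_i$ (if the two volumes are equal, either choice of $\delta_i$ is allowed). For a set $J\subset[n]$ with $m$ elements, an inflation of $V$ on the set $J$ is any code of the form $V^\delta=(\ldots(V^{\delta_{j_1}})^{\delta_{j_2}}\ldots)^{\delta_{j_m}}$, where $(j_1,\ldots,j_m)$ is some ordering of the elements of $J$ and, at each step $k$, writing $W$ for the code obtained at the previous step (with $W=V$ when $k=1$), the parameter $\delta_{j_k}\in\{0,1\}$ satisfies $\operatorname{vol}(W^{j_k,1-\delta_{j_k}})\le\operatorname{vol}(W^{j_k,\delta_{j_k}})$ and the code produced at step $k$ is the inflation $W^{\delta_{j_k}}=W^{j_k,\delta_{j_k},*}\cup W^{j_k,*}$ of $W$ at the $j_k$-th position; here $\delta=(\delta_{j_k})_{k\in[m]}$. *)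

(* Defs.v *)
From mathcomp Require Import all_boot.

Set Implicit Arguments.
Unset Strict Implicit.
Unset Printing Implicit Defensive.

(* The letters 0, 1 and * are Some false, Some true and None.                 *)
(* Positions are the elements of 'I_n, so position k of [n] = {1, ..., n} is  *)
(* the ordinal of value k - 1; in particular position 1 is ord0 : 'I_n.+1.    *)
Notation letter := (option bool).
Notation word n := {ffun 'I_n -> letter}.

Definition prop_set (n : nat) (v : word n) : {set 'I_n} :=
  [set i | v i != None].

(* The sum a + b is taken in nat, through the coercion from bool. *)
Definition dichotomous_at (n : nat) (v u : word n) (i : 'I_n) : bool :=
  match v i, u i with
  | Some a, Some b => a + b == 1
  | _, _ => false
  end.

Definition dichotomous (n : nat) (v u : word n) : bool :=
  [exists i, dichotomous_at v u i].

Definition neighborly (n : nat) (v u : word n) : bool :=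
  #|[set i | dichotomous_at v u i]| == 1.

Definition code (n : nat) (V : {set word n}) : Prop :=
  forall v u, v \in V -> u \in V -> v != u -> dichotomous v u.

Definition neighborly_code (n : nat) (V : {set word n}) : Prop :=
  forall v u, v \in V -> u \in V -> v != u -> neighborly v u.

Definition d_code (n d : nat) (V : {set word n}) : Prop :=
  code V /\ forall v, v \in V -> #|prop_set v| = d.

Definition neighborly_d_code (n d : nat) (V : {set word n}) : Prop :=
  d_code d V /\ neighborly_code V.

Definition wsize (n : nat) (v : word n) : nat := 2 ^ (n - #|prop_set v|).

Definition vol (n : nat) (V : {set word n}) : nat := \sum_(v in V) wsize v.

Definition slice (n : nat) (V : {set word n}) (j : 'I_n) (a : letter) :
    {set word n} :=
  [set v in V | v j == a].

(* The positions a, ..., b in the 1-based numbering of [n]. *)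
Definition positions (n a b : nat) : {set 'I_n} :=
  [set k : 'I_n | a <= k.+1 <= b].

Definition C1 (n : nat) (V : {set word n.+1}) (e : bool) : {set 'I_n.+1} :=
  [set k | (k != ord0) &&
     [exists v in slice V ord0 (Some e),
        [exists u in slice V ord0 (Some e), dichotomous_at v u k]]].

Definition free_positions (n : nat) (V : {set word n.+1}) : {set 'I_n.+1} :=
  ~: (ord0 |: C1 V false :|: C1 V true).

Definition standard_form (n : nat) (V : {set word n.+1}) : Prop :=
  [/\ #|slice V ord0 (Some false)| =
        \max_(p : 'I_n.+1 * bool) #|slice V p.1 (Some p.2)|,
      2 <= #|slice V ord0 (Some false)| /\ 2 <= #|slice V ord0 (Some true)|,
      exists s r : nat,
        [/\ 1 <= s <= n.+1, 1 <= r <= n.+1,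
            C1 V false = positions n.+1 2 s &
            C1 V true = positions n.+1 s.+1 r] &
      forall k v, k \in free_positions V ->
        v \in slice V ord0 (Some false) :|: slice V ord0 (Some true) ->
        v k = Some false \/ v k = None].

Definition star_at (n : nat) (i : 'I_n) (v : word n) : word n :=
  [ffun k => if k == i then None else v k].

Definition inflate (n : nat) (V : {set word n}) (i : 'I_n) (e : bool) :
    {set word n} :=
  [set star_at i v | v in slice V i (Some e)] :|: slice V i None.

Definition inflation_at (n : nat) (i : 'I_n) (V W : {set word n}) : Prop :=
  exists e : bool,
    vol (slice V i (Some (~~ e))) <= vol (slice V i (Some e)) /\
    W = inflate V i e.

Fixpoint inflation_along (n : nat) (js : seq 'I_n) (V W : {set word n}) :
    Prop :=
  match js with
  | [::] => W = V
  | j :: js' => exists U, inflation_at j V U /\ inflation_along js' U W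
  end.

Definition inflation_on (n : nat) (J : {set 'I_n}) (V W : {set word n}) :
    Prop :=
  exists js : seq 'I_n,
    [/\ uniq js, js =i J & inflation_along js V W].

Definition zero_star (n : nat) : word n.+1 :=
  [ffun i => if i == ord0 then Some false else None].

(* Main.v *)
(* A word is the box of 0-1 points that it matches, so a code is a packing of
   the cube by boxes.  An inflation never loses volume, keeps the code neighborly
   and leaves V^{1,1} untouched.  After C^1_0 has been inflated, at most one word
   x starting with 0 is left, since two of them could only differ in C^1_0.
   Reflecting the cube in one coordinate shows that V^{1,0} and V^{1,1} have
   sizes within M of each other, so x exists.  If x had a second letter, at a
   position k, the same reflection argument in the half-cube of points with k-th
   coordinate 1 would show that only O(M) words of V^{1,0} and V^{1,1} have a star
   at k, so V^{k,0} would be larger than V^{1,0}, which is excluded by (i).  Hence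
   x = 0*...* and no word starting with a star survives.  If volume were not
   gained, all steps would be ties, and a word of V^{1,*} could be kept instead.
   The argument applies equally to C^1_1, and adding both gains gives the
   cardinality bounds. *)
Require Import Defs.
From mathcomp Require Import all_boot.
From mathcomp Require Import zify.

Set Implicit Arguments.
Unset Strict Implicit.
Unset Printing Implicit Defensive.

(** * Dichotomy, slices and neighborly codes *)

Lemma dichotomous_atP n (v u : word n) i :
  reflect (exists a, v i = Some a /\ u i = Some (~~ a)) (dichotomous_at v u i).
Proof.
rewrite /dichotomous_at; apply: (iffP idP) => [|[a [-> ->]]]; last by case: a.
by case: (v i) (u i) => [[]|] [[]|] //= _; [exists true | exists false].
Qed.

Lemma in_slice n (V : {set word n}) i a v :
  (v \in slice V i a) = (v \in V) && (v i == a).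
Proof. by rewrite inE. Qed.

Lemma slice_sub n (V : {set word n}) i a : slice V i a \subset V.
Proof. by apply/subsetP => v; rewrite in_slice => /andP[]. Qed.

Lemma slice_sum n (V : {set word n}) i (F : word n -> nat) :
  \sum_(v in V) F v = \sum_(v in slice V i (Some false)) F v +
    \sum_(v in slice V i (Some true)) F v + \sum_(v in slice V i None) F v.
Proof.
rewrite (bigID (fun v : word n => v i == None)) /= addnC; congr (_ + _).
  rewrite (bigID (fun v : word n => v i == Some false)) /=; congr (_ + _).
    by apply: eq_bigl => v; rewrite in_slice; case: (v i) => [[]|]; rewrite ?andbT ?andbF.
  by apply: eq_bigl => v; rewrite in_slice; case: (v i) => [[]|]; rewrite ?andbT ?andbF.
by apply: eq_bigl => v; rewrite in_slice.
Qed.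

Lemma vol_slices n (V : {set word n}) i :
  vol V = vol (slice V i (Some false)) + vol (slice V i (Some true)) +
    vol (slice V i None).
Proof. exact: slice_sum. Qed.

Lemma card_slices n (V : {set word n}) i :
  #|V| = #|slice V i (Some false)| + #|slice V i (Some true)| + #|slice V i None|.
Proof. by rewrite -!sum1_card; exact: slice_sum. Qed.

Lemma neighborly_code_code n (V : {set word n}) : neighborly_code V -> code V.
Proof.
move=> V_ngh v u vV uV vu; move/cards1P: (V_ngh v u vV uV vu) => [i Ei].
by apply/existsP; exists i; move: (set11 i); rewrite -Ei inE.
Qed.

Lemma neighborly_unique n (V : {set word n}) v u i j :
  neighborly_code V -> v \in V -> u \in V ->
  dichotomous_at v u i -> dichotomous_at v u j -> i = j.
Proof.
move=> V_ngh vV uV vui vuj; have vu : v != u.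
  apply/eqP=> E; move/dichotomous_atP: vui => [a []].
  by rewrite E => -> []; case: a.
move/cards1P: (V_ngh v u vV uV vu) => [k /setP Ek].
by move: (Ek i) (Ek j); rewrite !inE vui vuj => /esym/eqP-> /esym/eqP->.
Qed.

(** * Boxes of 0-1 points and reflection in one coordinate *)

Notation point n := {ffun 'I_n -> bool}.

Definition box n (v : word n) : {set point n} :=
  [set x : point n | [forall i, v i \in [:: None; Some (x i)]]].

Definition face n (k : 'I_n) (b : bool) : {set point n} := [set x : point n | x k == b].

Definition flip n (i : 'I_n) (x : point n) : point n :=
  [ffun j => if j == i then ~~ x j else x j].

Lemma in_box n (v : word n) (x : point n) :
  reflect (forall i a, v i = Some a -> x i = a) (x \in box v).
Proof.
rewrite inE; apply: (iffP forallP) => [H i a E|H i].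
  by move: (H i); rewrite E !inE /= => /eqP[->].
by case E: (v i) => [a|] //; rewrite -(H i a E) !inE eqxx orbT.
Qed.

Lemma flipK n (i : 'I_n) : involutive (flip i).
Proof. by move=> x; apply/ffunP => j; rewrite !ffunE; case: eqP => // _; rewrite negbK. Qed.

Lemma flip_box n (i : 'I_n) (v : word n) x :
  v i = None -> (flip i x \in box v) = (x \in box v).
Proof.
move=> Ei; have sub y : y \in box v -> flip i y \in box v.
  move=> /in_box H; apply/in_box => j a E; rewrite ffunE.
  by case: eqP => [ji|_]; [rewrite ji Ei in E | exact: H].
by apply/idP/idP => /sub //; rewrite flipK.
Qed.

Lemma card_box n (v : word n) : #|box v| = wsize v.
Proof.
(* [F i] holds the values that [v] allows at [i]. The box is their product, and a position
   contributes 2 if it is a star and 1 otherwise. *)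
pose F i : pred bool := [pred b | v i \in [:: None; Some b]].
have -> : #|box v| = #|(family F : pred (point n))|.
  by apply: eq_card => x; rewrite inE; apply/forallP/familyP => H i; move: (H i); rewrite !inE.
rewrite card_family foldrE big_image /= /wsize.
rewrite (bigID (mem (prop_set v))) /= big1 ?mul1n => [|i].
  rewrite (eq_bigr (fun=> 2)) => [|i]; last first.
    rewrite inE negbK => /eqP Ei; rewrite -card_bool; apply: eq_card => b.
    by rewrite !inE Ei.
  rewrite prod_nat_const; congr (2 ^ _).
  rewrite -[X in X - _]card_ord -(cardC (mem (prop_set v))) addKn.
  by apply: eq_card => i; rewrite !inE.
rewrite inE; case Ei: (v i) => [a|] // _.
by rewrite -(card1 a); apply: eq_card => b; rewrite !inE Ei /= eq_sym.
Qed.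

Lemma disjoint_box n (v u : word n) : dichotomous v u -> [disjoint box v & box u].
Proof.
move=> /existsP[i /dichotomous_atP[a [vi ui]]].
rewrite disjoint_subset; apply/subsetP => x /in_box xv; apply/negP => /in_box xu.
by move: (xv _ _ vi) (xu _ _ ui) => ->; case: a {vi ui}.
Qed.

(** Dichotomous words have disjoint boxes. The region [R] will be the whole cube or one of its
    half-cubes. *)
Lemma card_bigcup_box n (V U : {set word n}) (R : {set point n}) :
  code V -> U \subset V ->
  #|\bigcup_(v in U) (box v :&: R)| = \sum_(v in U) #|box v :&: R|.
Proof.
move=> V_code /subsetP UV.
rewrite [RHS]big_mkcond [X in #|pred_of_set X|]big_mkcond /= -sum1_card.
rewrite (partition_disjoint_bigcup addn (fun=> 1)) => [|v u vu].
  by apply: eq_bigr => v _; rewrite sum1_card; case: ifP => // _; rewrite cards0.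
case: ifP => [vU|_]; last by rewrite -setI_eq0 set0I.
case: ifP => [uU|_]; last by rewrite -setI_eq0 setI0.
apply: disjointW (disjoint_box (V_code v u (UV v vU) (UV u uU) vu)); exact: subsetIl.
Qed.

Lemma card_bigcup_box_vol n (V : {set word n}) :
  code V -> #|\bigcup_(v in V) box v| = vol V.
Proof.
move=> V_code; rewrite /vol; under [RHS]eq_bigr do rewrite -card_box -(setIT (box _)).
rewrite -(card_bigcup_box setT V_code) //; congr #|pred_of_set _|.
by apply: eq_bigr => v _; rewrite setIT.
Qed.

(* Flipping the i-th coordinate maps a point covered by a word of V^{i,a} to
   a point that no word of V^{i,*} covers: it is uncovered or covered by
   V^{i,1-a}. *)
Lemma box_balance n (V : {set word n}) i a (R : {set point n}) :
  code V -> (forall x, x \in R -> flip i x \in R) ->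
  \sum_(v in slice V i (Some a)) #|box v :&: R| + vol V <=
  \sum_(v in slice V i (Some (~~ a))) #|box v :&: R| + 2 ^ n.
Proof.
move=> V_code R_flip.
rewrite -!(card_bigcup_box R V_code) ?slice_sub // -card_bigcup_box_vol //.
set A := \bigcup_(v in slice V i (Some a)) _.
set A' := \bigcup_(v in slice V i (Some (~~ a))) _.
set B := \bigcup_(v in V) box v.
have <- : #|B| + #|~: B| = 2 ^ n by rewrite cardsC card_ffun card_bool card_ord.
have sub : [set flip i x | x in A] \subset A' :|: ~: B.
  apply/subsetP => _ /imsetP[x /bigcupP[v vS /setIP[xv xR]] ->].
  move: vS; rewrite in_slice => /andP[vV /eqP vi].
  rewrite in_setU in_setC orbC -implybE; apply/implyP => /bigcupP[u uV xu].
  apply/bigcupP; exists u; last by rewrite inE xu R_flip.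
  rewrite in_slice uV /=; case ui: (u i) => [b|].
    move/in_box: xu => /(_ i b ui); rewrite ffunE eqxx => <-.
    by move/in_box: xv => /(_ i a vi) ->.
  rewrite flip_box // in xu; have [vu|/(V_code v u vV uV)] := eqVneq v u.
    by rewrite -vu vi in ui.
  by move=> /disjoint_box /disjoint_setI0 /setP /(_ x); rewrite in_setI in_set0 xv xu.
have := subset_leq_card sub; rewrite (card_imset _ (inv_inj (@flipK n i))).
move=> A_le; rewrite addnCA addnC leq_add2l (leq_trans A_le) //.
exact: leq_card_setU.
Qed.

Lemma vol_balance n (V : {set word n}) i a : code V ->
  vol (slice V i (Some a)) + vol V <= vol (slice V i (Some (~~ a))) + 2 ^ n.
Proof.
move=> V_code; have := @box_balance _ V i a setT V_code (fun x _ => in_setT (flip i x)).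
suff E (W : {set word n}) : \sum_(v in W) #|box v :&: setT| = vol W by rewrite !E.
by apply: eq_bigr => v _; rewrite setIT card_box.
Qed.

Lemma card_box_face_star n (v : word n) k b :
  v k = None -> 2 * #|box v :&: face k b| = wsize v.
Proof.
move=> vk; rewrite -card_box -(cardsID (face k b) (box v)) mul2n -addnn; congr (_ + _).
rewrite -(card_imset _ (inv_inj (@flipK n k))); apply: eq_card => x.
apply/imsetP/setDP => [[y /setIP[yv yk] ->]|[xv xk]].
  by rewrite flip_box // yv; split=> //; move: yk; rewrite !inE ffunE eqxx => /eqP->; case: b.
exists (flip k x); last by rewrite flipK.
by rewrite in_setI flip_box // xv; move: xk; rewrite !inE ffunE eqxx; case: (x k); case: b.
Qed.

Lemma box_face_opp n (v : word n) k b :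
  v k = Some (~~ b) -> box v :&: face k b = set0.
Proof.
move=> vk; apply/setP => x; rewrite in_setI in_set0; apply/negP => /andP[/in_box xv].
by rewrite inE (xv k _ vk); case: b {vk}.
Qed.

(** A word with the opposite letter at [k] misses the face, and a word with a star at [k] has
    exactly half of its box in it. *)
Lemma sum_box_face_opp n (V : {set word n}) k b :
  (forall v, v \in V -> v k = Some (~~ b) \/ v k = None) ->
  2 * (\sum_(v in V) #|box v :&: face k b|) = vol (slice V k None).
Proof.
move=> Vk; rewrite (slice_sum V k) mulnDr.
rewrite [X in X + _](_ : _ = 0).
  rewrite big_distrr; apply: eq_bigr => v; rewrite in_slice => /andP[_ /eqP].
  exact: card_box_face_star.
suff S c : \sum_(v in slice V k (Some c)) #|box v :&: face k b| = 0 by rewrite !S.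
apply: big1 => v; rewrite in_slice => /andP[/Vk + /eqP vk].
by rewrite vk => -[[E]|//]; rewrite box_face_opp ?cards0 // vk E.
Qed.

(** * Inflations: volume, neighborliness and the origin of words *)

Lemma star_at_id n (i : 'I_n) (v : word n) : v i = None -> star_at i v = v.
Proof. by move=> vi; apply/ffunP => j; rewrite ffunE; case: eqP => // ->. Qed.

(** Both pieces of an inflation are the image of the words that survive under the single map
    [star_at i]. *)
Lemma inflateE n (V : {set word n}) i e :
  inflate V i e = [set star_at i v | v in V & v i != Some (~~ e)].
Proof.
apply/setP => w; apply/setUP/imsetP => [[/imsetP[v]|]|[v]].
- rewrite in_slice => /andP[vV /eqP vi] ->; exists v => //.
  by rewrite inE vV vi; case: e {vi}.
- rewrite in_slice => /andP[wV /eqP wi]; exists w; last by rewrite star_at_id.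
  by rewrite inE wV wi.
rewrite inE => /andP[vV]; case vi: (v i) => [a|] vi' ->.
  left; apply/imsetP; exists v => //; rewrite in_slice vV vi.
  by case: a e vi vi' => [] [].
by right; rewrite star_at_id // in_slice vV vi.
Qed.

Lemma dichotomous_at_star n (i : 'I_n) (v u : word n) e :
  v i != Some (~~ e) -> u i != Some (~~ e) ->
  dichotomous_at (star_at i v) (star_at i u) =1 dichotomous_at v u.
Proof.
move=> vi ui j; rewrite /dichotomous_at !ffunE; case: eqP => // ->.
by case: (v i) (u i) e vi ui => [[]|] [[]|] [].
Qed.

(** Surviving words never differ at [i] by opposite letters, so a dichotomy between two of them
    persists in their images, which are therefore distinct. *)
Lemma star_at_inj n (V : {set word n}) i e : code V ->
  {in [set v in V | v i != Some (~~ e)] &, injective (star_at i)}.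
Proof.
move=> V_code v u; rewrite !inE => /andP[vV vi] /andP[uV ui] E.
apply: contraTeq isT => /(V_code v u vV uV) /existsP[k].
rewrite -(dichotomous_at_star vi ui) E => /dichotomous_atP[a [-> []]].
by case: a.
Qed.

Lemma inflate_neighborly n (V : {set word n}) i e :
  neighborly_code V -> neighborly_code (inflate V i e).
Proof.
move=> V_ngh w w'; rewrite inflateE => /imsetP[v + ->] /imsetP[u + ->].
rewrite !inE => /andP[vV vi] /andP[uV ui] vu.
rewrite /neighborly; under eq_finset do rewrite (dichotomous_at_star vi ui).
by apply: V_ngh => //; apply: contraNneq vu => ->.
Qed.

Lemma card_prop_set n (v : word n) : #|prop_set v| <= n.
Proof. by rewrite -[X in _ <= X]card_ord max_card. Qed.

Lemma wsize_star_at n (v : word n) i :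
  v i != None -> wsize (star_at i v) = 2 * wsize v.
Proof.
move=> vi; rewrite /wsize -expnS; congr (2 ^ _).
have -> : prop_set (star_at i v) = prop_set v :\ i.
  by apply/setP => j; rewrite !inE ffunE; case: (j == i).
have := card_prop_set v; rewrite (cardsD1 i (prop_set v)) inE vi add1n => le.
by rewrite subnS prednK // subn_gt0.
Qed.

Lemma vol_inflate n (V : {set word n}) i e : code V ->
  vol (inflate V i e) = 2 * vol (slice V i (Some e)) + vol (slice V i None).
Proof.
move=> V_code; rewrite /vol inflateE big_imset; last exact: star_at_inj.
rewrite (bigID (fun v : word n => v i == None)) /= addnC big_distrr /=; congr (_ + _).
  apply: eq_big => [v|v /andP[_ vi]]; last exact: wsize_star_at.
  by rewrite in_slice inE; case: (v i) e => [[]|] []; rewrite ?andbT ?andbF.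
apply: eq_big => [v|v /andP[_ /eqP vi]]; last by rewrite star_at_id.
by rewrite in_slice inE; case: (v i) => [?|]; rewrite ?andbT ?andbF.
Qed.

Lemma vol_inflate_sub n (V : {set word n}) i e : code V ->
  vol (inflate V i e) + vol (slice V i (Some (~~ e))) =
  vol V + vol (slice V i (Some e)).
Proof. move=> V_code; rewrite vol_inflate // (vol_slices V i); case: e => /=; lia. Qed.

Lemma inflation_at_le n i (V W : {set word n}) :
  code V -> inflation_at i V W -> vol V <= vol W.
Proof. by move=> V_code [e [+ ->]]; have := vol_inflate_sub i e V_code; lia. Qed.

Lemma inflation_at_exists n i (V : {set word n}) : exists W, inflation_at i V W.
Proof.
have [le|/ltnW le] := leqP (vol (slice V i (Some true))) (vol (slice V i (Some false))).
  by exists (inflate V i false), false.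
by exists (inflate V i true), true.
Qed.

Lemma inflation_along_exists n js (V : {set word n}) :
  exists W, inflation_along js V W.
Proof.
elim: js V => [|j js IH] V; first by exists V.
have [U VU] := inflation_at_exists j V; have [W UW] := IH U.
by exists W, U.
Qed.

Lemma inflation_at_neighborly n i (V W : {set word n}) :
  neighborly_code V -> inflation_at i V W -> neighborly_code W.
Proof. by move=> V_ngh [e [_ ->]]; exact: inflate_neighborly. Qed.

Lemma inflation_along_neighborly n js (V W : {set word n}) :
  neighborly_code V -> inflation_along js V W -> neighborly_code W.
Proof.
elim: js V => [|j js IH] V V_ngh /=; first by move->.
by case=> U [VU UW]; apply: IH UW; exact: inflation_at_neighborly VU.
Qed.

Lemma inflation_along_le n js (V W : {set word n}) :
  neighborly_code V -> inflation_along js V W -> vol V <= vol W.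
Proof.
elim: js V => [|j js IH] V V_ngh /=; first by move->.
case=> U [VU UW]; apply: leq_trans (inflation_at_le _ VU) _.
  exact: neighborly_code_code.
by apply: IH UW; exact: inflation_at_neighborly VU.
Qed.

Lemma inflation_along_origin n js (V W : {set word n}) w :
  inflation_along js V W -> w \in W ->
  exists2 v, v \in V & forall i, w i = if i \in js then None else v i.
Proof.
elim: js V => [|j js IH] V /=; first by move=> ->; exists w.
case=> U [[e [_ ->]]] /IH{}IH /IH[u]; rewrite inflateE => /imsetP[v + ->] wE.
rewrite inE => /andP[vV _]; exists v => // i; rewrite wE ffunE inE.
by case: eqP => // _; case: ifP.
Qed.

Lemma inflation_along_star n js (V W : {set word n}) v :
  inflation_along js V W -> v \in V -> (forall i, i \in js -> v i = None) ->
  v \in W.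
Proof.
elim: js V => [|j js IH] V /=; first by move->.
case=> U [[e [_ ->]]] /IH{}IH vV vjs; apply: IH => [|i ijs]; last first.
  by rewrite vjs // inE ijs orbT.
rewrite inflateE; apply/imsetP; exists v; first by rewrite inE vV vjs ?mem_head.
by rewrite star_at_id // vjs ?mem_head.
Qed.

(* If no inflation gains volume, every step is a tie, so the side containing
   the image of a given word may always be kept. *)
Lemma inflation_along_tie n js (V : {set word n}) v :
  neighborly_code V -> (forall W, inflation_along js V W -> vol W <= vol V) ->
  v \in V ->
  exists W w, [/\ inflation_along js V W, w \in W &
    forall i, i \notin js -> w i = v i].
Proof.
elim: js V v => [|j js IH] V v V_ngh no_gain vV; first by exists V, v.
have V_code := neighborly_code_code V_ngh.
(* It is enough to find one legal step that keeps the image of [v]: since [vol V <= vol U], no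
   further inflation of [U] gains volume either. *)
have step U : inflation_at j V U -> star_at j v \in U ->
    exists W w, [/\ inflation_along (j :: js) V W, w \in W &
      forall i, i \notin j :: js -> w i = v i].
  move=> VU vU; have U_ngh := inflation_at_neighborly V_ngh VU.
  have [W UW|W [w [UW wW wE]]] := IH U _ U_ngh _ vU.
    by apply: leq_trans (inflation_at_le V_code VU); apply: no_gain; exists U.
  exists W, w; split=> //; first by exists U.
  by move=> i; rewrite inE negb_or => /andP[ij ijs]; rewrite wE // ffunE (negbTE ij).
case vj: (v j) => [e|]; last first.
  have [U VU] := inflation_at_exists j V; apply: (step _ VU).
  case: VU => e [_ ->]; rewrite inflateE; apply: imset_f.
  by rewrite inE vV vj.
apply: (step (inflate V j e)); last first.
  by rewrite inflateE; apply: imset_f; rewrite inE vV vj; case: e {vj}.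
(* If keeping [e] were illegal, keeping [~~ e] would gain volume strictly, and later steps would not
   lose that gain. *)
exists e; split=> //; rewrite leqNgt; apply/negP => lt.
have VU : inflation_at j V (inflate V j (~~ e)).
  by exists (~~ e); rewrite negbK; split=> //; exact: ltnW.
have [W UW] := inflation_along_exists js (inflate V j (~~ e)).
have := inflation_along_le (inflation_at_neighborly V_ngh VU) UW.
have := vol_inflate_sub j (~~ e) V_code; rewrite negbK.
have : vol W <= vol V by apply: no_gain; exists (inflate V j (~~ e)).
lia.
Qed.

(** * Volumes of d-codes and stars forced by neighborliness *)

Lemma vol_d_code n d (V U : {set word n}) :
  d_code d V -> U \subset V -> vol U = #|U| * 2 ^ (n - d).
Proof.
move=> [_ V_d] /subsetP UV; rewrite -sum_nat_const; apply: eq_bigr => v vU.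
by rewrite /wsize V_d ?UV.
Qed.

Lemma d_code_le n d (V : {set word n}) v : d_code d V -> v \in V -> d <= n.
Proof. by move=> [_ V_d] /V_d <-; exact: card_prop_set. Qed.

(** Two words of the opposite slice carry both letters at [k]. If [v] had a letter there, one of
    them would be dichotomous to [v] at [k] as well as at [ord0]. *)
Lemma slice_C1_star n (V : {set word n.+1}) a v k :
  neighborly_code V -> v \in slice V ord0 (Some a) -> k \in C1 V (~~ a) ->
  v k = None.
Proof.
move=> V_ngh; rewrite !in_slice inE => /andP[vV /eqP v0] /andP[k0].
case vk: (v k) => [c|] // /existsP[u /andP[uS /existsP[t /andP[tS]]]].
move=> /dichotomous_atP[b [uk tk]].
have [w wS wk] : exists2 w, w \in slice V ord0 (Some (~~ a)) & w k = Some (~~ c).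
  have [bc|bc] := eqVneq b c; first by exists t; rewrite // -bc.
  by exists u => //; rewrite uk; case: b c bc {vk uk tk} => [] [].
move: wS; rewrite in_slice => /andP[wV /eqP w0]; case/eqP: k0.
by apply: (neighborly_unique V_ngh vV wV); apply/dichotomous_atP;
  [exists c | exists a].
Qed.

(** * The inflation on [C1 V e], for either value of [e] *)

Section InflationOnC1.

Variables (n d M : nat) (V : {set word n.+1}).
Hypotheses (V_code : neighborly_d_code d V)
  (V_free : forall k v, k \in free_positions V ->
     v \in slice V ord0 (Some false) :|: slice V ord0 (Some true) ->
     v k = Some false \/ v k = None)
  (V_max : forall k : 'I_n.+1,
     #|slice V k (Some false)| <= #|slice V ord0 (Some false)|)
  (card_V : #|V| + M = 2 ^ d)
  (card_V10 : 9 * M < #|slice V ord0 (Some false)|).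

Let V_ngh : neighborly_code V := V_code.2.
Let c := 2 ^ (n.+1 - d).

(** Turns balances of volumes into bounds on numbers of words. As [2 ^ n.+1 = 2 ^ d * c], the words
    of [V] leave [M * c] points uncovered and [W] leaves at most as many; then divide by [c]. The
    factor [t] is 2 when half-boxes are counted. *)
Lemma deficit_le t m m' (W : {set word n.+1}) : vol V <= vol W ->
  m * c + t * vol W <= m' * c + t * 2 ^ n.+1 -> m <= m' + t * M.
Proof.
have : 0 < #|slice V ord0 (Some false)| by exact: leq_ltn_trans card_V10.
case/card_gt0P => v /(subsetP (slice_sub V _ _)) /(d_code_le V_code.1) d_le.
rewrite (vol_d_code V_code.1 (subxx V)) -/c.
have -> : 2 ^ n.+1 = 2 ^ d * c by rewrite -expnD subnKC.
rewrite -card_V.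
move=> le_VW le; rewrite -(@leq_pmul2r c) ?expn_gt0 //; nia.
Qed.

Lemma card_slice0_le a :
  #|slice V ord0 (Some a)| <= #|slice V ord0 (Some (~~ a))| + M.
Proof.
rewrite -[X in _ + X]mul1n; apply: (@deficit_le 1 _ _ V) => //; rewrite !mul1n.
rewrite -!(vol_d_code V_code.1 (slice_sub V _ _)).
exact: vol_balance (neighborly_code_code V_ngh).
Qed.

Lemma free_letter k v e :
  k \in free_positions V -> v \in slice V ord0 (Some e) ->
  v k = Some false \/ v k = None.
Proof.
by move=> kD vS; apply: V_free kD _; rewrite in_setU; case: e vS => ->; rewrite ?orbT.
Qed.

Variables (e : bool) (js : seq 'I_n.+1) (W : {set word n.+1}).
Hypotheses (js_C1 : js =i C1 V e) (VW : inflation_along js V W).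

Let W_ngh : neighborly_code W := inflation_along_neighborly V_ngh VW.

Lemma ord0_notin_js : ord0 \notin js.
Proof. by rewrite js_C1 inE eqxx. Qed.

Lemma origin0 w a : w \in slice W ord0 (Some a) ->
  exists2 v, v \in slice V ord0 (Some a) &
    forall i, w i = if i \in js then None else v i.
Proof.
rewrite in_slice => /andP[wW w0]; have [v vV wE] := inflation_along_origin VW wW.
by exists v; rewrite // in_slice vV -(eqP w0) wE (negbTE ord0_notin_js) eqxx.
Qed.

(** Words of this slice of [V] have stars on all of [C1 V e], so the inflation does not change
    them. *)
Lemma slice0_opp : slice W ord0 (Some (~~ e)) = slice V ord0 (Some (~~ e)).
Proof.
have js_star v i : v \in slice V ord0 (Some (~~ e)) -> i \in js -> v i = None.
  by move=> vS; rewrite js_C1 -[e]negbK; exact: slice_C1_star.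
apply/setP => w; apply/idP/idP => [/origin0[v vS wE]|wS].
  suff -> : w = v by [].
  by apply/ffunP => i; rewrite wE; case: ifP => // /(js_star v i vS).
have := wS; rewrite !in_slice => /andP[wV ->]; rewrite andbT.
by apply: (inflation_along_star VW) => // i; exact: js_star.
Qed.

(** A dichotomy between two such words lies outside [js] and is inherited from words of [V] with
    first letter [e]; but then its position belongs to [C1 V e]. *)
Lemma slice0_same_unique : {in slice W ord0 (Some e) &, forall w w', w = w'}.
Proof.
move=> w w' wS w'S; apply: contraTeq isT => ww'.
have /(neighborly_code_code W_ngh) : w \in W := subsetP (slice_sub _ _ _) _ wS.
move=> /(_ w' (subsetP (slice_sub _ _ _) _ w'S) ww') /existsP[k].
have [v vS wE] := origin0 wS; have [v' v'S wE'] := origin0 w'S.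
rewrite /dichotomous_at wE wE'; case: ifP => // kjs vk.
move/negbT: kjs; rewrite js_C1 inE negb_and negbK.
have [k0|k0] := eqVneq k ord0; last first.
  by move=> /existsP[]; exists v; rewrite vS; apply/existsP; exists v'; rewrite v'S.
move: vk vS v'S; rewrite k0 !in_slice => + /andP[_ /eqP vE] /andP[_ /eqP vE'].
by rewrite vE vE'; case: e.
Qed.

(** Otherwise reflecting [W] at [ord0] bounds the opposite slice by [M], hence [V^{1,0}] by
    [2 * M]. *)
Lemma slice0_same_nonempty : slice W ord0 (Some e) != set0.
Proof.
apply/eqP => W0.
have := vol_balance ord0 (~~ e) (neighborly_code_code W_ngh).
rewrite negbK W0 slice0_opp (vol_d_code V_code.1 (slice_sub V _ _)).
rewrite /vol big_set0 -(mul0n c) => le.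
have := @deficit_le 1 _ _ _ (inflation_along_le V_ngh VW); rewrite !mul1n => /(_ _ _ le).
have := card_slice0_le false; have := card_slice0_le true.
by move: card_V10; case: (e) => /=; lia.
Qed.

(* The counts p a and q a of 0s and stars at k satisfy q <= 4M, whereas
   p false + p true <= |V^{k,0}|. *)
Lemma slice0_same_letter x k :
  x \in slice W ord0 (Some e) -> k != ord0 -> x k = None.
Proof.
move=> xS k0; have [v vS xE] := origin0 xS.
have [//|kjs] := boolP (k \in js); first by rewrite xE => ->.
case vk: (v k) => [b|]; last by rewrite xE (negbTE kjs).
(* [k] avoids [C1 V e] because it is not in [js], and avoids [C1 V (~~ e)] because [v] has a letter
   there. *)
have kD : k \in free_positions V.
  rewrite in_setC !in_setU in_set1 !negb_or k0 andTb.
  have kCe : k \notin C1 V e by rewrite -js_C1.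
  have kCe' : k \notin C1 V (~~ e).
    by apply/negP => /(slice_C1_star V_ngh vS); rewrite vk.
  by case: (e) kCe kCe' => -> ->.
have xk : x k = Some false.
  by rewrite xE (negbTE kjs); case: (free_letter kD vS); rewrite vk.
pose p a := #|slice (slice V ord0 (Some a)) k (Some false)|.
pose q a := #|slice (slice V ord0 (Some a)) k None|.
have pq a : #|slice V ord0 (Some a)| = p a + q a.
  rewrite (card_slices _ k) [X in _ + X + _](_ : _ = 0) ?addn0 //.
  apply/eqP; rewrite cards_eq0 -subset0; apply/subsetP => u.
  by rewrite in_slice => /andP[/(free_letter kD)[] ->].
have face_q a : 2 * \sum_(u in slice V ord0 (Some a)) #|box u :&: face k true| = q a * c.
  rewrite sum_box_face_opp => [|u uS]; last exact: free_letter kD uS.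
  by apply: vol_d_code V_code.1 _; exact: subset_trans (slice_sub _ _ _) (slice_sub _ _ _).
have face_flip y : y \in face k true -> flip ord0 y \in face k true.
  by rewrite !inE ffunE (negbTE k0).
have q_le : q e <= q (~~ e) + 2 * M.
  apply: (@deficit_le 2 _ _ V) => //; rewrite -!face_q -!mulnDr leq_mul2l /=.
  exact: box_balance (neighborly_code_code V_ngh) face_flip.
(* The only word of [W] with first letter [e] is [x], whose 0 at [k] keeps its box out of the face;
   so the right-hand count is 0. *)
have q_opp_le : q (~~ e) <= 0 + 2 * M.
  apply: (@deficit_le 2 _ _ W); first exact: inflation_along_le VW.
  rewrite -face_q mul0n add0n -mulnDr leq_mul2l /= -slice0_opp.
  have := box_balance (~~ e) (neighborly_code_code W_ngh) face_flip.
  rewrite negbK [X in _ <= X + _ -> _]big1 // => y yS.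
  by rewrite (slice0_same_unique yS xS) box_face_opp ?cards0.
have p_le : p false + p true <= #|slice V ord0 (Some false)|.
  apply: leq_trans (V_max k); rewrite -cardsUI [X in _ + X](_ : _ = 0) ?addn0.
    apply: subset_leq_card; apply/subsetP => u; rewrite in_setU !in_slice.
    by case/orP=> /andP[/andP[-> _] ->].
  apply/eqP; rewrite cards_eq0 -subset0; apply/subsetP => u.
  by rewrite in_setI !in_slice => /andP[/andP[/andP[_ /eqP->] _]]; rewrite andbF.
(* There are at most [6 * M] stars at [k] in the two slices. With [p_le] this gives at most [6 * M]
   words in [V^{1,1}], hence at most [7 * M] in [V^{1,0}], against [card_V10]. *)
have := card_slice0_le false; have := card_slice0_le true.
move: p_le q_le q_opp_le (pq false) (pq true) card_V10; case: (e) => /=; lia.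
Qed.

(** The remaining word [x] with first letter [e] has no other letter, so every other word of [W]
    must be dichotomous to it at [ord0]. *)
Lemma inflation_C1 :
  W = [ffun i => if i == ord0 then Some e else None] |: slice V ord0 (Some (~~ e)).
Proof.
have /set0Pn[x xS] := slice0_same_nonempty.
have x0 : x ord0 = Some e by move: xS; rewrite in_slice => /andP[_ /eqP].
have xE : x = [ffun i => if i == ord0 then Some e else None].
  by apply/ffunP => i; rewrite ffunE; case: eqVneq => [->|/(slice0_same_letter xS)].
have xW : x \in W := subsetP (slice_sub _ _ _) _ xS.
rewrite -xE -slice0_opp; apply/setP => w; rewrite in_setU1 in_slice.
apply/idP/orP => [wW|[/eqP->|/andP[]]] //.
have [->|wx] := eqVneq w x; [by left | right; rewrite wW /=].
have /existsP[i /dichotomous_atP[a []]] : dichotomous x w.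
  by apply: neighborly_code_code W_ngh _ _ xW wW _; rewrite eq_sym.
by rewrite xE ffunE; case: eqP => // -> [->] ->.
Qed.

End InflationOnC1.

(** * Volume gain and cardinality bounds when some word starts with a star *)

Section Star.

Variables (n d M : nat) (V : {set word n.+1}).
Hypotheses (V_code : neighborly_d_code d V)
  (V_free : forall k v, k \in free_positions V ->
     v \in slice V ord0 (Some false) :|: slice V ord0 (Some true) ->
     v k = Some false \/ v k = None)
  (V_max : forall k : 'I_n.+1,
     #|slice V k (Some false)| <= #|slice V ord0 (Some false)|)
  (card_V : #|V| + M = 2 ^ d)
  (card_V10 : 9 * M < #|slice V ord0 (Some false)|)
  (V_star : slice V ord0 None <> set0).

Let inflationE := inflation_C1 V_code V_free V_max card_V card_V10.

(** All inflations along [js] yield the same code, so if one gains nothing, none does. Ties then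
    allow keeping the image of a word starting with a star, and this code contains no such word. *)
Lemma vol_lt_inflation e js W :
  js =i C1 V e -> inflation_along js V W -> vol V < vol W.
Proof.
move=> js_C1 VW; rewrite ltnNge; apply/negP => le_WV.
have /eqP/set0Pn[v] := V_star; rewrite in_slice => /andP[vV /eqP v0].
have [W' VW'|W' [w [VW' + wE]]] := inflation_along_tie V_code.2 _ vV (js := js).
  by rewrite (inflationE js_C1 VW') -(inflationE js_C1 VW).
have w0 : w ord0 = None by rewrite wE ?(ord0_notin_js js_C1).
rewrite (inflationE js_C1 VW') in_setU1 in_slice w0 andbF orbF => /eqP w_e.
by move: w0; rewrite w_e ffunE.
Qed.

(** In the comparison of [vol V] with its inflation, the common slice [~~ e] cancels. What is left
    is the other words of [V] against one half-cube, of volume [2 ^ (d - 1) * c]. *)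
Lemma card_slice0_lt e : 0 < d ->
  #|slice V ord0 (Some e)| + #|slice V ord0 None| < 2 ^ (d - 1).
Proof.
move=> d_pos; pose js := enum (C1 V e).
have js_C1 : js =i C1 V e by move=> k; rewrite mem_enum.
have [W VW] := inflation_along_exists js V.
have := vol_lt_inflation js_C1 VW; rewrite (inflationE js_C1 VW).
rewrite {2}/vol big_setU1 /=; last by rewrite in_slice ffunE eqxx andbC; case: (e).
rewrite -/(vol _) !(vol_d_code V_code.1) ?slice_sub //.
have /eqP/set0Pn[v /(subsetP (slice_sub _ _ _)) /(d_code_le V_code.1) d_le] := V_star.
have -> : wsize [ffun i : 'I_n.+1 => if i == ord0 then Some e else None] =
    2 ^ (d - 1) * 2 ^ (n.+1 - d).
  rewrite /wsize (_ : prop_set _ = [set ord0]) ?cards1.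
    by rewrite -expnD; congr (2 ^ _); lia.
  by apply/setP => i; rewrite !inE ffunE; case: (i == ord0).
rewrite -mulnDl ltn_pmul2r ?expn_gt0 // (card_slices V ord0).
by case: (e) => /=; lia.
Qed.

End Star.

Theorem corollary1 (n d M s : nat) (V : {set word n.+1})
    (d_pos : 1 <= d)
    (V_code : neighborly_d_code d V)
    (V_std : standard_form V)
    (s_range : 1 <= s <= n.+1)
    (C10_eq : C1 V false = positions n.+1 2 s)
    (M_ge2 : 2 <= M)
    (card_V : #|V| + M = 2 ^ d)
    (card_V10 : 9 * M < #|slice V ord0 (Some false)|) :
  (forall W : {set word n.+1}, inflation_on (positions n.+1 2 s) V W ->
     W = [set zero_star n] :|: slice V ord0 (Some true))
  /\
  (slice V ord0 None <> set0 ->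
     [/\ forall W : {set word n.+1}, inflation_on (positions n.+1 2 s) V W ->
           vol V < vol W,
         #|slice V ord0 None| < M,
         2 ^ (d - 1) < #|slice V ord0 (Some false)| + M &
         2 ^ (d - 1) < #|slice V ord0 (Some true)| + M]).
Proof.
have [V10_max _ _ V_free] := V_std; rewrite -C10_eq.
have V_max (k : 'I_n.+1) : #|slice V k (Some false)| <= #|slice V ord0 (Some false)|.
  rewrite V10_max.
  exact: (@leq_bigmax _ (fun p : 'I_n.+1 * bool => #|slice V p.1 (Some p.2)|) (k, false)).
split=> [W [js [_ js_C1 VW]]|V_star].
  exact: (inflation_C1 V_code V_free V_max card_V card_V10 js_C1 VW).
have lt0 := card_slice0_lt V_code V_free V_max card_V card_V10 V_star false d_pos.
have lt1 := card_slice0_lt V_code V_free V_max card_V card_V10 V_star true d_pos.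
have pow_d : 2 ^ d = 2 * 2 ^ (d - 1) by rewrite -expnS subn1 prednK.
(* Adding [lt0] and [lt1] bounds [V^{1,*}]; subtracting one of them from [card_V] bounds the
   opposite slice from below. *)
move: (card_V) lt0 lt1; rewrite pow_d (card_slices V ord0) => cardE lt0 lt1.
split; [move=> W [js [_ js_C1 VW]] | lia | lia | lia].
exact: (vol_lt_inflation V_code V_free V_max card_V card_V10 V_star js_C1 VW).
Qed.
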